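(* Let $m$ be a positive integer, suppose that the index set $T$ is a bounded subset of $\mathbb{R}^m$, and let $\|\cdot\|$ be any norm on $\mathbb{R}^m$. If there is some Borel measurable map $F\colon\mathbb{R}\to\mathbb{R}$ such that $\int_{\mathbb{R}}|f(x)|F(x)\,\mathrm{d}x<+\infty$ and $$|p_s(x)-p_t(x)|\leqslant\|s-t\|\,F(x)\quad\text{for all }s,t\in T\text{ and }x\in\mathbb{R},$$ then the importance sampling estimator $\hat{\underline{\mathrm{E}}}_n^{\mathscr{P}/P}(f)$ is a strongly consistent estimator of $\underline{\mathrm{E}}^{\mathscr{P}}(f)$.
   Context: Setting. $\mathscr{B}$ is the Borel $\sigma$-field on $\mathbb{R}$. $T$ is a non-empty index set and $\mathscr{P}=\{P_t : t\in T\}$ is a set of probability measures on $(\mathbb{R},\mathscr{B})$, each absolutely continuous with respect to Lebesgue measure, with density $p_t$. $P$ is a (central) probability measure on $(\mathbb{R},\mathscr{B})$, not necessarily in $\mathscr{P}$, that is also absolutely continuous, with density $p$. With $\operatorname{supp}q:=\{x\in\mathbb{R}: q(x)>0\}$ for a density $q$, it is assumed that $\operatorname{supp}p\supseteq\operatorname{supp}p_t$ for all $t\in T$. For a probability measure $Q$, $\mathrm{E}^Q(h)=\int h\,\mathrm{d}Q$. The map $f\colon\mathbb{R}\to\mathbb{R}$ is Borel measurable with $\sup_{t\in T}\mathrm{E}^{P_t}(|f|)<+\infty$, and $\underline{\mathrm{E}}^{\mathscr{P}}(f):=\inf_{t\in T}\mathrm{E}^{P_t}(f)$. For each $t\in T$,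 $f_t\colon\mathbb{R}\to\mathbb{R}$ is a Borel measurable map that satisfies $f_t(x)=f(x)\,p_t(x)/p(x)$ for all $x\in\operatorname{supp}p$ (values outside $\operatorname{supp}p$, a $P$-null set, are irrelevant). Sampling. $(\mathbb{R}^\infty,\mathscr{B}^\infty,P^\infty)$ is the countably infinite product of copies of $(\mathbb{R},\mathscr{B},P)$ and $X_k\colon\mathbb{R}^\infty\to\mathbb{R}$ is the $k$-th coordinate projection. The importance sampling estimator is the (not necessarily measurable) extended real-valued map $$\hat{\underline{\mathrm{E}}}_n^{\mathscr{P}/P}(f):=\inf_{t\in T}\frac1n\sum_{k=1}^n f_t(X_k)\quad\Big(=\inf_{t\in T}\frac1n\sum_{k=1}^n f(X_k)\frac{p_t(X_k)}{p(X_k)}\ \text{ when all } X_k\in\operatorname{supp}p\Big).$$ Strong consistency. For any map $h\colon\mathbb{R}^\infty\to\overline{\mathbb{R}}:=\mathbb{R}\cup\{-\infty,+\infty\}$, $h^*$ denotes a minimal measurable cover: a measurable map $h^*\colon\mathbb{R}^\infty\to\overline{\mathbb{R}}$ with $h^*\geqslant h$ and such that every measurable $g\colon\mathbb{R}^\infty\to\overline{\mathbb{R}}$ with $g\geqslant h$ satisfies $g\geqslant h^*$ $P^\infty$-almost surely; it always exists and is unique up to $P^\infty$-null sets. The estimator is strongly consistent if $\big|\hat{\underline{\mathrm{E}}}_n^{\mathscr{P}/P}(f)-\underline{\mathrm{E}}^{\mathscr{P}}(f)\big|^*\to0$ $P^\infty$-almost surely as $n\to+\infty$, where $|h|^*$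 is the minimal measurable cover of $|h|$. *)

(* Defs.v *)
From HB Require Import structures.
From mathcomp Require Import all_boot all_order all_algebra.
From mathcomp Require Import all_classical all_reals all_analysis.
From mathcomp Require Import measurable_realfun.

Set Implicit Arguments.
Unset Strict Implicit.
Unset Printing Implicit Defensive.

Import Order.TTheory GRing.Theory Num.Theory.
Import numFieldNormedType.Exports.

Local Open Scope classical_set_scope.
Local Open Scope ring_scope.
Local Open Scope ereal_scope.

Definition is_norm (R : realType) (m : nat) (N : 'rV[R]_m -> R) : Prop :=
  [/\ forall v, (0 <= N v)%R,
      forall v, N v = 0%R -> v = 0%R,
      forall (a : R) v, N (a *: v)%R = (`|a| * N v)%R &
      forall u v, (N (u + v) <= N u + N v)%R].

(* In particular Q is absolutely continuous w.r.t. Lebesgue measure; conversely,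
   by Radon-Nikodym, every absolutely continuous probability measure has such a
   finite-valued, nonnegative Borel density. *)
Definition is_density (R : realType) (Q : probability (measurableTypeR R) R)
    (q : R -> R) : Prop :=
  [/\ measurable_fun [set: measurableTypeR R] q,
      forall x, (0 <= q x)%R &
      forall A : set (measurableTypeR R), measurable A ->
        Q A = \int[lebesgue_measure]_(x in A) (q x)%:E].

(* The set where a density is positive (not its topological closure). *)
Definition supp (R : realType) (q : R -> R) : set R := [set x | (0 < q x)%R].

Definition lower_expectation (R : realType) (I : Type) (T : set I)
    (P : I -> probability (measurableTypeR R) R) (f : R -> R) : \bar R :=
  ereal_inf [set 'E_(P t)[f] | t in T].

Definition coord_preimages (R : realType) : set (set (nat -> R)) :=
  [set A | exists (k : nat) (B : set (measurableTypeR R)),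
     measurable B /\ A = (fun w : nat -> R => w k) @^-1` B].

(* The space of real sequences with the product sigma-algebra. *)
Definition Rinfty (R : realType) := g_sigma_algebraType (@coord_preimages R).

(* The product condition on finite-dimensional measurable rectangles, which form
   a pi-system generating the product sigma-algebra; it therefore determines
   Pinf uniquely. *)
Definition is_infinite_power (R : realType)
    (P : probability (measurableTypeR R) R)
    (Pinf : probability (Rinfty R) R) : Prop :=
  forall (n : nat) (B : nat -> set (measurableTypeR R)),
    (forall k, measurable (B k)) ->
    Pinf [set w : Rinfty R | forall k, (k < n)%N -> B k (w k)]
    = \prod_(k < n) P (B k).

(* The sample X_1, X_2, ... is w 0, w 1, ...; the value at n = 0 is a dummy. *)
Definition importance_estimator (R : realType) (I : Type) (T : set I)
    (ft : I -> R -> R) (n : nat) (w : Rinfty R) : \bar R :=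
  ereal_inf [set ((n%:R)^-1 * \sum_(k < n) ft t (w k))%R%:E | t in T].

Definition is_min_measurable_cover (d : measure_display)
    (Omega : measurableType d) (R : realType)
    (mu : {measure set Omega -> \bar R}) (h hstar : Omega -> \bar R) : Prop :=
  [/\ measurable_fun [set: Omega] hstar,
      forall w, h w <= hstar w &
      forall g : Omega -> \bar R, measurable_fun [set: Omega] g ->
        (forall w, h w <= g w) -> {ae mu, forall w, hstar w <= g w}].

(* Covers always exist and are a.e. unique, so the choice of the covers is
   irrelevant; the existential form cannot hold vacuously. *)
Definition strongly_consistent (d : measure_display)
    (Omega : measurableType d) (R : realType)
    (mu : {measure set Omega -> \bar R})
    (est : nat -> Omega -> \bar R) (theta : \bar R) : Prop :=
  exists hstar : nat -> Omega -> \bar R,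
    (forall n, is_min_measurable_cover mu
       (fun w => `|est n w - theta|) (hstar n)) /\
    {ae mu, forall w, hstar n w @[n --> \oo] --> (0 : \bar R)}.

(* Main.v *)
Require Import Defs.
From HB Require Import structures.
From mathcomp Require Import all_boot all_order all_algebra.
From mathcomp Require Import all_classical all_reals all_analysis.
From mathcomp Require Import measurable_realfun.
From mathcomp Require Import ring lra.
Import Order.TTheory GRing.Theory Num.Theory.
Import numFieldNormedType.Exports.
Local Open Scope classical_set_scope.
Local Open Scope ring_scope.
Local Open Scope ereal_scope.

(* The Lipschitz bound gives |f_t - f_s| <= |s - t| G on supp p, where
   G = |f| F / p is P-integrable because |f| F is Lebesgue-integrable.  As T is
   totally bounded, finitely many f_s approximate all f_t up to e G, so the
   strong law of large numbers for G and for countably many f_s makes the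
   sample means converge to the expectations uniformly in t, almost surely, and
   the infima converge too.  On the almost sure event that all X_k lie in
   supp p, the infimum over T is an infimum over a countable subset of T; this
   makes the estimator measurable off a null set and provides the minimal
   measurable cover.

   The strong law is obtained from the maximal ergodic inequality for the shift.
   An integrable g is approximated in L^1 by a bounded b, and the mean of N
   terms of b - E b is small in L^1 by independence.  Applying the inequality to
   H = |g - b| + |mean of N terms of b - E b| bounds all the averages of H along
   the orbit of the shift outside an event of small probability, and averages of
   averages of b differ from averages of b by O(1/n) since b is bounded. *)

(** * Cylinders, shift and coordinates under the infinite product measure *)

Section infinite_power.
Set Implicit Arguments.
Unset Strict Implicit.
Context (R : realType).
Implicit Types (w : Rinfty R) (B : nat -> set (measurableTypeR R)).

Definition coordinate (k : nat) (w : Rinfty R) : measurableTypeR R := w k.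

Lemma measurable_coord (k : nat) :
  measurable_fun [set: Rinfty R] (coordinate k).
Proof.
by move=> _ B mB; rewrite setTI; apply: sub_sigma_algebra; exists k, B.
Qed.

Definition cylinder (n : nat) B : set (Rinfty R) :=
  [set w | forall k, (k < n)%N -> B k (w k)].

Lemma measurable_cylinder n B :
  (forall k, measurable (B k)) -> measurable (cylinder n B).
Proof.
move=> mB; rewrite (_ : cylinder n B =
    \bigcap_(k in [set k | (k < n)%N]) (coordinate k @^-1` B k)).
  apply: bigcap_measurableType => k _.
  by rewrite -[X in measurable X]setTI; exact: measurable_coord.
by [].
Qed.

(** Cylinders form a pi-system that generates the product sigma-algebra, and the whole space is the
    cylinder of length 0. *)
Lemma cylinder_measure_unique (m1 : probability (Rinfty R) R)
    (m2 : {measure set (Rinfty R) -> \bar R}) :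
    (forall n B, (forall k, measurable (B k)) ->
      m1 (cylinder n B) = m2 (cylinder n B)) ->
  forall A, measurable A -> m1 A = m2 A.
Proof.
move=> m12 A mA.
pose G : set (set (Rinfty R)) :=
  [set C | exists n B, (forall k, measurable (B k)) /\ C = cylinder n B].
apply: (measure_unique G (fun=> setT)) => //.
- apply/seteqP; split.
  + apply: smallest_sub; first exact: smallest_sigma_algebra.
    move=> _ [k [B [mB ->]]]; apply: sub_sigma_algebra.
    exists k.+1, (fun j => if j == k then B else setT); split.
      by move=> j; case: ifP.
    apply/seteqP; split => w /=; last by move/(_ k); rewrite eqxx; exact.
    by move=> Bw j _; case: eqP => // ->.
  + apply: smallest_sub; first exact: sigma_algebra_measurable.
    by move=> _ [n [B [mB ->]]]; exact: measurable_cylinder.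
- move=> _ _ [n [B [mB ->]]] [p [C [mC ->]]].
  (* Both cylinders are brought to the common length [maxn n p] by padding with [setT]. *)
  exists (maxn n p), (fun k => (if (k < n)%N then B k else setT) `&`
                      (if (k < p)%N then C k else setT)); split.
    by move=> k; apply: measurableI; case: ifP.
  apply/seteqP; split => w /=.
    by move=> [Bw Cw] k _; split; case: ifPn => // ?; [exact: Bw|exact: Cw].
  move=> BCw; split => k kn.
    by have := BCw k; rewrite leq_max kn => /(_ isT)[].
  by have := BCw k; rewrite leq_max kn orbT => /(_ isT)[].
- move=> _; exists 0%N, (fun=> setT); split => //.
  by apply/seteqP; split.
- by rewrite bigcup_const//; exists 0%N.
- by move=> _ [n [B [mB ->]]]; exact: m12.
- by move=> _; apply: (le_lt_trans (probability_le1 _ _)) => //; rewrite ltry.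
Qed.

Definition left_shift (w : Rinfty R) : Rinfty R := fun k => w k.+1.

Lemma measurable_shift : measurable_fun [set: Rinfty R] left_shift.
Proof.
have := @measurability _ _ (Rinfty R) (Rinfty R) setT left_shift
  (@coord_preimages R).
apply => //.
move=> _ [_ [k [B [mB ->]]] <-]; rewrite setTI; apply: sub_sigma_algebra.
by exists k.+1, B.
Qed.

HB.instance Definition _ :=
  isMeasurableFun.Build _ _ _ _ left_shift measurable_shift.
HB.instance Definition _ k :=
  isMeasurableFun.Build _ _ _ _ (coordinate k) (measurable_coord k).

Section laws.
Context (P : probability (measurableTypeR R) R).
Context (Pinf : probability (Rinfty R) R) (hP : is_infinite_power P Pinf).

Let cylinderE n B : (forall k, measurable (B k)) ->
  Pinf (cylinder n B) = \prod_(k < n) P (B k).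
Proof. by move=> mB; exact: hP. Qed.

(** The preimage of a cylinder is a cylinder with the new first side [setT], which contributes a
    factor 1; cylinders determine the measure. *)
Lemma shift_invariant A : measurable A -> Pinf (left_shift @^-1` A) = Pinf A.
Proof.
move=> mA; apply/esym; move: A mA.
apply: (@cylinder_measure_unique Pinf (distribution Pinf left_shift)) => n B mB.
pose B' k := if k is j.+1 then B j else setT.
rewrite -[RHS]/(Pinf (left_shift @^-1` cylinder n B)).
have -> : left_shift @^-1` cylinder n B = cylinder n.+1 B'.
  apply/seteqP; split => w /= h; last by move=> k kn; exact: (h k.+1).
  by case=> [|k] kn; [|exact: (h k kn)].
rewrite !cylinderE; [|by case=> [|k]; [exact: measurableT|exact: mB]|by []].
by rewrite big_ord_recl /= probability_setT mul1e.
Qed.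

Lemma coord_law i A : measurable A -> Pinf (coordinate i @^-1` A) = P A.
Proof.
move=> mA.
have -> : coordinate i @^-1` A =
    cylinder i.+1 (fun k => if k == i then A else setT).
  apply/seteqP; split => w /=; last by move/(_ i); rewrite eqxx; exact.
  by move=> Aw k _; case: eqP => // ->.
rewrite cylinderE; last by move=> k; case: ifP.
rewrite (bigD1 (@ord_max i))//= eqxx big1 ?mule1// => j.
by rewrite -val_eqE /= => /negbTE ->; exact: probability_setT.
Qed.

(** Pairwise independence, from which [integral_uncorrelated] draws the joint law of two
    coordinates. *)
Lemma coord_pair_law i j A C : i != j -> measurable A -> measurable C ->
  Pinf (coordinate i @^-1` A `&` coordinate j @^-1` C) = P A * P C.
Proof.
move=> ij mA mC; pose n := (maxn i j).+1.
have -> : coordinate i @^-1` A `&` coordinate j @^-1` C =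
    cylinder n (fun k => if k == i then A else if k == j then C else setT).
  apply/seteqP; split => w /=.
    by move=> [Aw Cw] k _; case: eqP => [->//|_]; case: eqP => // ->.
  move=> h; split; first by have := h i; rewrite eqxx; apply;
    rewrite ltnS leq_maxl.
  have := h j; rewrite eqxx eq_sym (negbTE ij); apply.
  by rewrite ltnS leq_maxr.
rewrite cylinderE; last by move=> k; case: ifP => // _; case: ifP.
have il : (i < n)%N by rewrite ltnS leq_maxl.
have jl : (j < n)%N by rewrite ltnS leq_maxr.
rewrite (bigD1 (Ordinal il))//= eqxx (bigD1 (Ordinal jl))/=; last first.
  by rewrite -val_eqE /= eq_sym.
rewrite eqxx eq_sym (negbTE ij) big1 ?mule1// => k.
rewrite -!val_eqE /= => /andP[/negbTE -> /negbTE ->].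
exact: probability_setT.
Qed.

Lemma integral_coord i (u : R -> \bar R) :
    measurable_fun [set: measurableTypeR R] u -> (forall x, 0 <= u x) ->
  \int[Pinf]_w u (w i) = \int[P]_x u x.
Proof.
move=> mu u0.
rewrite -(@ge0_integral_distribution _ _ _ _ _ Pinf (coordinate i))//.
by apply: eq_measure_integral => A mA _; exact: coord_law.
Qed.

Lemma ge0_integral_shift (u : Rinfty R -> \bar R) :
    measurable_fun [set: Rinfty R] u -> (forall w, 0 <= u w) ->
  \int[Pinf]_w u (left_shift w) = \int[Pinf]_w u w.
Proof.
move=> mu u0.
rewrite -(@ge0_integral_distribution _ _ _ _ _ Pinf left_shift)//.
by apply: eq_measure_integral => A mA _; exact: shift_invariant.
Qed.

End laws.
End infinite_power.

(** * The maximal ergodic inequality for a measure-preserving map *)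

Section maximal_ergodic.
Set Implicit Arguments.
Unset Strict Implicit.
Context d (Omega : measurableType d) (R : realType) (Q : probability Omega R).
Context (theta : Omega -> Omega) (mtheta : measurable_fun setT theta).
Context (invariant : forall u : Omega -> \bar R,
  measurable_fun setT u -> (forall w, 0 <= u w) ->
  \int[Q]_w u (theta w) = \int[Q]_w u w).
Context (H : Omega -> R) (mH : measurable_fun setT H).
Context (H0 : forall w, (0 <= H w)%R).
Context (intH : \int[Q]_w (H w)%:E < +oo).
Context (l : R) (l0 : (0 < l)%R).


(* M n is the maximum of 0 and of the sums of H - l over the first 1, ..., n
   points of the orbit; this recursion is all that the proof uses. *)
Let Fixpoint M n w : R :=
  if n is n'.+1 then Num.max 0%R (H w - l + M n' (theta w))%R else 0%R.

Let MS n w : M n.+1 w = Num.max 0%R (H w - l + M n (theta w))%R.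
Proof. by []. Qed.

Let M_ge0 n w : (0 <= M n w)%R.
Proof. by case: n => //= n; rewrite le_max lexx. Qed.

Let measurable_M n : measurable_fun setT (M n).
Proof.
elim: n => [|n IH]; first exact: measurable_cst.
apply: measurable_maxr; first exact: measurable_cst.
apply: measurable_funD; first exact: measurable_funB.
exact: measurableT_comp.
Qed.

Let M_nondecreasing n w : (M n w <= M n.+1 w)%R.
Proof.
elim: n w => [|n IH] w; first exact: M_ge0.
by rewrite !MS ge_max !le_max lexx lerD2l IH orbT.
Qed.

Let pos n := [set w | (0 < M n w)%R].

Let measurable_pos n : measurable (pos n).
Proof.
rewrite (_ : pos n = setT `&` M n @^-1` `]0%R, +oo[%classic).
  exact: measurable_M.
by rewrite setTI; apply/seteqP; split => w; rewrite /= in_itv/= andbT.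
Qed.

(** Where [M n.+1] is positive, the maximum is its second argument and equality holds; elsewhere the
    left side is 0. *)
Let M_step n w :
  (M n.+1 w + l * \1_(pos n.+1) w <= H w + M n (theta w))%R.
Proof.
rewrite indicE; have [Mw|/negP Mw] := boolP (w \in pos n.+1).
  have {}Mw : (0 < M n.+1 w)%R by move: Mw; rewrite inE.
  rewrite mulr1; move: Mw; rewrite MS lt_max ltxx orFb => Mw.
  by rewrite max_r ?(ltW Mw)//; lra.
rewrite mulr0 addr0.
have /eqP -> : M n.+1 w == 0%R.
  by rewrite eq_le M_ge0 leNgt andbT; apply/negP => h; apply: Mw; rewrite inE.
by rewrite addr_ge0.
Qed.

(** After integration of [M_step], invariance removes [theta] from the last integral. *)
Let integral_M_step n :
  \int[Q]_w (M n.+1 w)%:E + l%:E * Q (pos n.+1) <=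
  \int[Q]_w (H w)%:E + \int[Q]_w (M n w)%:E.
Proof.
rewrite -(invariant (u := EFin \o M n))//; last 2 first.
- exact/measurable_EFinP.
- by move=> w; rewrite lee_fin.
have mI : measurable_fun setT (fun w => (\1_(pos n.+1) w)%:E : \bar R).
  exact/measurable_EFinP/measurable_indic.
rewrite (_ : l%:E * Q (pos n.+1) =
    \int[Q]_w (l%:E * (\1_(pos n.+1) w)%:E)); last first.
  by rewrite ge0_integralZl// ?lee_fin ?ltW// integral_indic// setIT.
rewrite -!ge0_integralD//.
- apply: ge0_le_integral => //.
  + by move=> w _; rewrite adde_ge0 ?mule_ge0 ?lee_fin// ltW.
  + apply: emeasurable_funD; first exact/measurable_EFinP.
    exact: measurable_funeM.
  + apply: emeasurable_funD; first exact/measurable_EFinP.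
    by apply/measurable_EFinP; exact: measurableT_comp.
  + by move=> w _; rewrite -EFinM -!EFinD lee_fin; exact: M_step.
- by move=> w _; rewrite lee_fin.
- exact/measurable_EFinP.
- by move=> w _; rewrite /= lee_fin.
- by apply/measurable_EFinP; exact: measurableT_comp.
- by move=> w _; rewrite lee_fin.
- exact/measurable_EFinP.
- by move=> w _; rewrite mule_ge0 ?lee_fin// ltW.
- by apply: measurable_funeM; exact/measurable_EFinP/measurable_indic.
Qed.

(** Finiteness justifies the cancellation in [measure_pos]. *)
Let integral_M_fin n : \int[Q]_w (M n w)%:E \is a fin_num.
Proof.
rewrite ge0_fin_numE; last by apply: integral_ge0 => w _; rewrite lee_fin.
elim: n => [|n IH]; first by rewrite integral0 ltry.
apply: le_lt_trans (lte_add_pinfty intH IH).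
apply: le_trans (integral_M_step n).
by rewrite leeDl// mule_ge0// lee_fin ltW.
Qed.

Let measure_pos n : Q (pos n) <= l^-1%:E * \int[Q]_w (H w)%:E.
Proof.
case: n => [|n].
  rewrite (_ : pos 0 = set0) ?measure0; last first.
    by apply/seteqP; split => // w; rewrite /pos /= ltxx.
  apply: mule_ge0; first by rewrite lee_fin invr_ge0 ltW.
  by apply: integral_ge0 => w _; rewrite lee_fin.
rewrite lee_pdivlMl//.
(* With this, the integral of [M n.+1] stands on both sides of the step inequality and cancels. *)
have MM : \int[Q]_w (M n w)%:E <= \int[Q]_w (M n.+1 w)%:E.
  apply: ge0_le_integral => //.
  - by move=> w _; rewrite lee_fin.
  - exact/measurable_EFinP.
  - exact/measurable_EFinP.
  - by move=> w _; rewrite lee_fin.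
have := le_trans (integral_M_step n) (leeD2l _ MM).
by rewrite addeC leeD2rE.
Qed.

Let birkhoff_le_M n w :
  (\sum_(i < n) H (iter i theta w) - n%:R * l <= M n w)%R.
Proof.
elim: n w => [|n IH] w; first by rewrite big_ord0 mul0r subr0.
rewrite MS le_max; apply/orP; right.
rewrite big_ord_recl /=.
under eq_bigr do rewrite -iterS iterSr.
by have := IH (theta w); rewrite -natr1 mulrDl mul1r; lra.
Qed.

(** [A] collects the points where some [M n] is positive. The sets [pos n] increase, so their common
    bound passes to the union; off [A], [birkhoff_le_M] bounds all the sums. *)
Lemma maximal_ergodic : exists A : set Omega,
  [/\ measurable A, Q A <= l^-1%:E * \int[Q]_w (H w)%:E &
    forall w, ~ A w -> forall n,
      (\sum_(i < n) H (iter i theta w) <= n%:R * l)%R].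
Proof.
exists (\bigcup_n pos n); split.
- exact: bigcupT_measurable.
- have cvgQ : Q \o pos @ \oo --> Q (\bigcup_n pos n).
    apply: nondecreasing_cvg_mu => //; first exact: bigcupT_measurable.
    apply/nondecreasing_seqP => n; apply/subsetPset => w.
    by rewrite /pos /= => h; apply: lt_le_trans (M_nondecreasing n w).
  rewrite -(cvg_lim _ cvgQ)//; apply: lime_le.
    by apply/cvg_ex; eexists; exact: cvgQ.
  by apply: nearW => n; exact: measure_pos.
- move=> w Aw n; rewrite -subr_le0; apply: le_trans (birkhoff_le_M n w) _.
  by rewrite leNgt; apply/negP => Mw; apply: Aw; exists n.
Qed.

End maximal_ergodic.

(** * The weak law in L^1 for bounded centered functions *)

Section law_of_large_numbers.
Set Implicit Arguments.
Unset Strict Implicit.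

Lemma bounded_integrable d (T : measurableType d) (R : realType)
    (mu : probability T R) (u : T -> R) (K : R) :
  measurable_fun setT u -> (forall x, (`|u x| <= K)%R) ->
  mu.-integrable setT (EFin \o u).
Proof.
move=> mu_ uK; apply: measurable_bounded_integrable => //.
  by rewrite (le_lt_trans (probability_le1 _ _))// ltry.
exists K; split; first exact: num_real.
by move=> x Kx y _; apply: le_trans (uK y) (ltW Kx).
Qed.

Context (R : realType) (P : probability (measurableTypeR R) R).
Context (Pinf : probability (Rinfty R) R) (hP : is_infinite_power P Pinf).

Section bounded_centered.
Context (Y : R -> R) (mY : measurable_fun [set: measurableTypeR R] Y).
Context (K : R) (YK : forall x, (`|Y x| <= K)%R).
Context (Y0 : \int[P]_x (Y x)%:E = 0).

Let mYc i : measurable_fun [set: Rinfty R] (fun w : Rinfty R => Y (w i)).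
Proof. exact: (measurableT_comp mY (@measurable_coord R i)). Qed.

Let K0 : (0 <= K)%R.
Proof. by apply: le_trans (YK 0%R). Qed.

Let YYK x y : (`|Y x * Y y| <= K ^+ 2)%R.
Proof. by rewrite normrM expr2 ler_pM. Qed.

(** The pair of coordinates has law [P \x P], and in the iterated integral the inner one is [Y x]
    times the mean 0 of [Y]. *)
Lemma integral_uncorrelated i j : i != j ->
  \int[Pinf]_w (Y (w i) * Y (w j))%:E = 0.
Proof.
move=> ij.
pose X (w : Rinfty R) : measurableTypeR R * measurableTypeR R := (w i, w j).
have mX : measurable_fun setT X.
  by apply/measurable_fun_pair; exact: measurable_coord.
pose u (z : measurableTypeR R * measurableTypeR R) : R := (Y z.1 * Y z.2)%R.
have mu : measurable_fun setT u.
  apply: measurable_funM.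
    exact: (measurableT_comp mY measurable_fst).
  exact: (measurableT_comp mY measurable_snd).
have uK z : (`|u z| <= K ^+ 2)%R by exact: YYK.
pose X' : {mfun Rinfty R >-> (measurableTypeR R * measurableTypeR R)%type} :=
  HB.pack X (isMeasurableFun.Build _ _ _ _ X mX).
transitivity (\int[distribution Pinf X']_z (u z)%:E).
  rewrite integral_distribution//; first exact/measurable_EFinP.
  apply: (@bounded_integrable _ _ _ _ (u \o X) (K ^+ 2)) => [|w].
    exact: measurableT_comp.
  exact: uK.
transitivity (\int[P \x P]_z (u z)%:E).
  apply: eq_measure_integral => A mA _; apply/esym.
  apply: product_measure_unique mA => A1 A2 mA1 mA2.
  by rewrite -(coord_pair_law hP ij mA1 mA2).
rewrite -integral12_prod_meas1; last first.
  exact: (@bounded_integrable _ _ _ _ _ (K ^+ 2)).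
rewrite /fubini_F /u /=.
rewrite (eq_integral (cst 0)) ?integral0// => x _.
under eq_integral do rewrite EFinM.
rewrite integralZl//; last exact: (@bounded_integrable _ _ _ _ _ K).
by rewrite Y0 mule0.
Qed.

(** Only the [n] diagonal terms of the expanded square survive, each at most [K ^+ 2]. *)
Lemma integral_sqr_sum n :
  \int[Pinf]_w ((\sum_(i < n) Y (w i)) ^+ 2)%:E <= (n%:R * K ^+ 2)%:E.
Proof.
under eq_integral do rewrite expr2 mulr_suml -sumEFin.
have intYY i j : Pinf.-integrable [set: Rinfty R]
    (EFin \o (fun w : Rinfty R => Y (w i) * Y (w j))%R).
  by apply: (@bounded_integrable _ _ _ Pinf _ (K ^+ 2)) => //;
    exact: measurable_funM.
under eq_integral do under eq_bigr do rewrite mulr_sumr -sumEFin.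
rewrite integral_sum//; last first.
  by move=> i; apply: integrable_sum => // j _; exact: intYY.
have -> : (n%:R * K ^+ 2)%:E = \sum_(i < n) (K ^+ 2)%:E.
  by rewrite sumEFin sumr_const card_ord mulr_natl.
apply: lee_sum => i _; rewrite integral_sum//; last first.
  by move=> j; exact: intYY.
rewrite (bigD1 i)//= big1 ?adde0.
  apply: le_trans (_ : \int[Pinf]_w (cst (K ^+ 2)%:E w) <= _).
    apply: le_integral => //.
    - exact: intYY.
    - exact: (finite_measure_integrable_cst Pinf (K ^+ 2)).
    - by move=> w _; rewrite lee_fin (le_trans (ler_norm _)).
  by rewrite integral_cst// [X in _ * X]probability_setT mule1.
by move=> j ji; rewrite integral_uncorrelated// eq_sym.
Qed.

(** The inequality |x| <= a + x^2 / a turns the second moment into an L^1 bound; with a = e / 2 and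
    n >= K^2 / a^2 both terms are at most e / 2. *)
Lemma weak_law_L1 (e : R) : (0 < e)%R -> exists n,
  (0 < n)%N /\ \int[Pinf]_w `|n%:R^-1 * \sum_(i < n) Y (w i)|%:E <= e%:E.
Proof.
move=> e0; pose a := (e / 2)%R; have a0 : (0 < a)%R by rewrite divr_gt0.
pose n := (Num.trunc (K ^+ 2 / a ^+ 2)).+1.
have nK : (K ^+ 2 / a ^+ 2 <= n%:R)%R.
  by rewrite ltW// truncnS_gt.
exists n; split => //.
have n0 : (0 < n%:R :> R)%R by rewrite ltr0n.
pose S (w : Rinfty R) : R := (\sum_(i < n) Y (w i))%R.
have mS : measurable_fun setT S by exact: measurable_sum.
(* Chosen so that c S^2 = x^2 / a for the mean x = S / n. *)
pose c : R := ((a * n%:R ^+ 2)^-1)%R.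
have c0 : (0 <= c)%R by rewrite invr_ge0 mulr_ge0 ?exprn_ge0// ltW.
apply: le_trans (_ : \int[Pinf]_w (a%:E + c%:E * (S w ^+ 2)%:E) <= _).
  apply: ge0_le_integral => //.
  - apply/measurable_EFinP/measurableT_comp => //.
    by apply: measurable_funM => //; exact: measurable_cst.
  - apply: emeasurable_funD; first exact: measurable_cst.
    by apply: measurable_funeM; apply/measurable_EFinP; exact: measurable_funX.
  - move=> w _; rewrite -EFinM -EFinD lee_fin -/(S w).
    have -> : (c * S w ^+ 2 = (n%:R^-1 * S w) ^+ 2 / a)%R.
      rewrite /c; field; lra.
    move: (n%:R^-1 * S w)%R => x.
    have [xa|xa] := leP `|x|%R a.
      by rewrite (le_trans xa)// lerDl divr_ge0 ?sqr_ge0// ltW.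
    rewrite -real_normK ?num_real// ler_wpDl// ?ltW//.
    by rewrite ltr_pdivlMr// expr2 ltr_pM2l// (lt_trans a0).
rewrite ge0_integralD//; first last.
- by apply: measurable_funeM; apply/measurable_EFinP; exact: measurable_funX.
- by move=> w _; rewrite mule_ge0// lee_fin sqr_ge0.
- by move=> w _; rewrite lee_fin ltW.
rewrite integral_cst// [X in _ * X + _]probability_setT mule1.
rewrite ge0_integralZl//; first last.
- by move=> w _; rewrite lee_fin sqr_ge0.
- by apply/measurable_EFinP; exact: measurable_funX.
apply: le_trans (_ : a%:E + c%:E * (n%:R * K ^+ 2)%:E <= _).
  by apply: leeD2l; apply: lee_wpmul2l;
    [rewrite lee_fin|exact: integral_sqr_sum].
rewrite -EFinM -EFinD lee_fin.
have -> : (c * (n%:R * K ^+ 2) = K ^+ 2 / a ^+ 2 * (a / n%:R))%R.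
  by rewrite /c; field; lra.
have -> : (e = a + n%:R * (a / n%:R))%R by rewrite /a; field; lra.
by rewrite lerD2l ler_wpM2r// divr_ge0// ltW.
Qed.

End bounded_centered.
End law_of_large_numbers.

(** * Deterministic bounds for averages of a bounded sequence *)

Section averages.
Set Implicit Arguments.
Unset Strict Implicit.
Local Open Scope ring_scope.
Context (R : realType) (y : nat -> R) (K : R).
Context (yK : forall i, `|y i| <= K).

(** Each shift by one gains one term and drops another, both bounded by [K]. *)
Lemma sum_shift_le (n j : nat) :
  `|\sum_(i < n) y (i + j)%N - \sum_(i < n) y i| <= j%:R * (2 * K).
Proof.
elim: j => [|j IH].
  by under eq_bigr do rewrite addn0; rewrite subrr normr0 mul0r.
have -> : \sum_(i < n) y (i + j.+1)%N =
    \sum_(i < n) y (i + j)%N + (y (n + j)%N - y j).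
  elim: n {IH} => [|n IH]; first by rewrite !big_ord0 add0n subrr addr0.
  by rewrite !big_ord_recr/= IH addnS addSn; ring.
rewrite addrAC (le_trans (ler_normD _ _))// -natr1 mulrDl mul1r.
rewrite lerD// (le_trans (ler_normB _ _))// mulr_natl mulr2n.
exact: lerD.
Qed.

(** The hypothesis is what the maximal inequality yields off the exceptional event. [Z] is the sum
    of the length-[N] averages of [y]; by [sum_shift_le] for the shifts below [N], replacing the sum
    of [y] by [Z] costs at most [N%:R * (2 * K)], whatever [n] is. *)
Lemma sum_le_of_averages (a : nat -> R) (c l : R) (N : nat) : (0 < N)%N ->
  (forall n, \sum_(i < n) (`|a i - c - y i| +
     `|N%:R^-1 * \sum_(j < N) y (i + j)%N|) <= n%:R * l) ->
  forall n, `|\sum_(i < n) a i - n%:R * c| <= n%:R * l + N%:R * (2 * K).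
Proof.
move=> N0 h n; have K0 : 0 <= K by apply: le_trans (yK 0).
have NR : 0 < N%:R :> R by rewrite ltr0n.
pose Z := \sum_(i < n) (N%:R^-1 * \sum_(j < N) y (i + j)%N).
have ZE : Z = N%:R^-1 * \sum_(j < N) \sum_(i < n) y (i + j)%N.
  by rewrite exchange_big/= mulr_sumr.
have Zy : `|\sum_(i < n) y i - Z| <= N%:R * (2 * K).
  have -> : \sum_(i < n) y i - Z = N%:R^-1 *
      \sum_(j < N) (\sum_(i < n) y i - \sum_(i < n) y (i + j)%N).
    rewrite sumrB sumr_const card_ord -[X in _ * (X - _)]mulr_natl.
    by rewrite ZE mulrBr mulKf ?gt_eqF.
  rewrite normrM gtr0_norm ?invr_gt0// ler_pdivrMl//.
  rewrite (le_trans (ler_norm_sum _ _ _))//.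
  apply: (@le_trans _ _ (\sum_(j < N) N%:R * (2 * K))).
    apply: ler_sum => j _; rewrite distrC (le_trans (sum_shift_le _ _))//.
    by rewrite ler_wpM2r ?mulr_ge0// ler_nat ltnW.
  by rewrite sumr_const card_ord -[leLHS]mulr_natl.
have -> : \sum_(i < n) a i - n%:R * c =
    \sum_(i < n) (a i - c - y i) + Z + (\sum_(i < n) y i - Z).
  by rewrite !sumrB sumr_const card_ord -[c *+ n]mulr_natl; ring.
rewrite (le_trans (ler_normD _ _))// lerD//.
apply: le_trans (h n); rewrite [leRHS]big_split/= (le_trans (ler_normD _ _))//.
by rewrite lerD// ler_norm_sum.
Qed.
End averages.

(** * The strong law for integrable functions *)

Section strong_law.
Set Implicit Arguments.
Unset Strict Implicit.
Context (R : realType) (P : probability (measurableTypeR R) R).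
Context (Pinf : probability (Rinfty R) R) (hP : is_infinite_power P Pinf).
Context (g : R -> R).
Context (intg : P.-integrable [set: measurableTypeR R] (EFin \o g)).

Let mg : measurable_fun [set: measurableTypeR R] g.
Proof. by apply/measurable_EFinP; exact: measurable_int intg. Qed.

Let mu : R := fine (\int[P]_x (g x)%:E).

Lemma iter_shift n (w : Rinfty R) k : iter n (@left_shift R) w k = w (n + k)%N.
Proof. by elim: n k => [|n IH] k //=; rewrite /left_shift IH addnS. Qed.

Import HBSimple.

(** Simple functions are bounded and dense in L^1. *)
Lemma L1_bounded_approx (e : R) : (0 < e)%R -> exists b : R -> R,
  [/\ measurable_fun [set: measurableTypeR R] b,
      exists K, forall x, (`|b x| <= K)%R &
      \int[P]_x `|g x - b x|%:E <= e%:E].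
Proof.
move=> e0; have [s [_ _ sg]] := approximation_sfun_integrable measurableT intg.
have [n sn] : exists n, \int[P]_x `|(g x)%:E - (s n x)%:E| < e%:E.
  move/fine_cvgP : sg => [sfin /cvgr0Pnorm_lt /(_ _ e0) slt].
  near \oo => n; exists n.
  have sn0 : 0 <= \int[P]_x `|(g x)%:E - (s n x)%:E| by exact: integral_ge0.
  have sf : \int[P]_x `|(g x)%:E - (s n x)%:E| \is a fin_num by near: n.
  rewrite -(fineK sf) lte_fin -[ltLHS]ger0_norm ?fine_ge0//.
  by near: n.
exists (s n); split; first exact: measurable_funPT.
  have [K [_ hK]] := simple_bounded (s n).
  by exists (K + 1)%R => x; apply: (hK (K + 1)%R) => //; rewrite ltrDl.
by rewrite (le_trans _ (ltW sn)).
Unshelve. all: by end_near. Qed.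

(** [l] sets the accuracy and [e] the size of the exceptional event. Three errors are at most [l]
    each: the maximal inequality, the boundary term [D] divided by [n], and the difference of the
    means of [b] and [g]. *)
Lemma average_near_mean (l e : R) : (0 < l)%R -> (0 < e <= l)%R ->
  exists A : set (Rinfty R), [/\ measurable A, Pinf A <= (l^-1 * (2 * e))%:E &
    forall w, ~ A w -> \forall n \near \oo,
      (`|n%:R^-1 * \sum_(i < n) g (w i) - mu| <= 3 * l)%R].
Proof.
move=> l0 /andP[e0 el].
have [b [mb [K bK] gb]] := L1_bounded_approx e0.
have intb : P.-integrable [set: measurableTypeR R] (EFin \o b).
  exact: (@bounded_integrable _ _ _ P b K).
pose c : R := fine (\int[P]_x (b x)%:E).
have cE : \int[P]_x (b x)%:E = c%:E by rewrite fineK// integrable_fin_num.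
have muE : \int[P]_x (g x)%:E = mu%:E by rewrite fineK// integrable_fin_num.
have cmu : (`|c - mu| <= e)%R.
  rewrite -lee_fin; apply: le_trans gb.
  rewrite distrC -abse_EFin EFinB -muE -cE -integralB//.
  apply: le_trans (le_abse_integral _ _ _) _ => //.
  exact/measurable_EFinP/measurable_funB.
pose Y x := (b x - c)%R.
have mY : measurable_fun [set: measurableTypeR R] Y.
  by apply: measurable_funB => //; exact: measurable_cst.
have YK x : (`|Y x| <= K + `|c|)%R.
  by rewrite (le_trans (ler_normB _ _))// lerD2r.
have Y0 : \int[P]_x (Y x)%:E = 0.
  under eq_integral do rewrite EFinB.
  rewrite integralB//; last exact: finite_measure_integrable_cst.
  by rewrite cE integral_cst// [X in _ * X]probability_setT mule1 subee.
have [N [N0 hN]] := weak_law_L1 hP mY YK Y0 e0.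
(* At the [i]-th point of the orbit, [H1] sees coordinate [i] and [H2] the window of [N] coordinates
   that starts at [i]. *)
pose H1 (w : Rinfty R) : R := `|g (w 0%N) - b (w 0%N)|%R.
pose H2 (w : Rinfty R) : R := `|N%:R^-1 * \sum_(j < N) Y (w j)|%R.
have mH1 : measurable_fun setT H1.
  apply: measurableT_comp => //; apply: measurable_funB.
    exact: (measurableT_comp mg (@measurable_coord R 0)).
  exact: (measurableT_comp mb (@measurable_coord R 0)).
have mH2 : measurable_fun setT H2.
  apply: measurableT_comp => //.
  apply: measurable_funM; first exact: measurable_cst.
  apply: measurable_sum => j.
  exact: (measurableT_comp mY (@measurable_coord R j)).
pose H w := (H1 w + H2 w)%R.
have mH : measurable_fun setT H by exact: measurable_funD.
have H0 w : (0 <= H w)%R by apply: addr_ge0; exact: normr_ge0.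
have intH : \int[Pinf]_w (H w)%:E <= (2 * e)%:E.
  under eq_integral do rewrite EFinD.
  rewrite ge0_integralD//; first last.
  - exact/measurable_EFinP.
  - by move=> w _; rewrite lee_fin; exact: normr_ge0.
  - exact/measurable_EFinP.
  - by move=> w _; rewrite lee_fin; exact: normr_ge0.
  rewrite mulr_natl mulr2n EFinD leeD//.
  rewrite (integral_coord hP 0 (u := fun x => `|g x - b x|%:E))//.
  apply/measurable_EFinP; apply: measurableT_comp => //.
  exact: measurable_funB.
have [A [mA QA hA]] := maximal_ergodic (@measurable_shift R)
  (ge0_integral_shift hP) mH H0 (le_lt_trans intH (ltry _)) l0.
exists A; split => //.
  apply: le_trans QA _; rewrite EFinM lee_wpmul2l// lee_fin invr_ge0 (ltW l0)//.
move=> w /hA {}hA.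
have {}hA n : (\sum_(i < n) (`|g (w i) - c - Y (w i)| +
     `|N%:R^-1 * \sum_(j < N) Y (w (i + j)%N)|) <= n%:R * l)%R.
  apply: le_trans (hA n); rewrite le_eqVlt; apply/orP; left; apply/eqP.
  apply: eq_bigr => i _; rewrite /H /H1 /H2 iter_shift addn0; congr (_ + _)%R.
    by congr (`|_|)%R; rewrite /Y; ring.
  by congr (`|_ * _|)%R; apply: eq_bigr => j _; rewrite iter_shift.
have := @sum_le_of_averages _ (fun i => Y (w i)) _ (fun i => YK (w i))
  (fun i => g (w i)) c l N N0 hA.
set D : R := (N%:R * _)%R => hD.
(* [D] is independent of [n], so it is at most [n%:R * l] once [n] exceeds [D / l]. *)
have [M MD] : exists M : nat, (D / l <= M%:R)%R.
  by exists (Num.trunc (D / l)).+1; rewrite ltW// truncnS_gt.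
exists M.+1 => // n /= Mn.
have n0 : (0 < n%:R :> R)%R by rewrite ltr0n (leq_trans _ Mn).
have Dn : (D <= n%:R * l)%R.
  by rewrite -ler_pdivrMr// (le_trans MD)// ler_nat ltnW.
have -> : (n%:R^-1 * \sum_(i < n) g (w i) - mu =
    n%:R^-1 * (\sum_(i < n) g (w i) - n%:R * c) + (c - mu))%R.
  by rewrite mulrBr mulKf ?gt_eqF//; ring.
rewrite (le_trans (ler_normD _ _))//.
rewrite (_ : 3 * l = 2 * l + l)%R; last by ring.
rewrite lerD ?(le_trans cmu)// normrM gtr0_norm ?invr_gt0//.
rewrite ler_pdivrMl// (le_trans (hD n))//.
by rewrite mulrCA mulrDl mul1r lerD2l.
Qed.

Theorem strong_law_of_large_numbers : {ae Pinf, forall w : Rinfty R,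
  (n%:R^-1 * \sum_(i < n) g (w i))%R @[n --> \oo] --> mu}.
Proof.
have negl (l : R) : (0 < l)%R ->
    {ae Pinf, forall w : Rinfty R, \forall n \near \oo,
    (`|n%:R^-1 * \sum_(i < n) g (w i) - mu| <= 3 * l)%R}.
  move=> l0.
  (* This gives [A k] probability at most 2 / (k + 1), so the intersection of all [A k] is null. *)
  pose e k := (l / k.+1%:R)%R.
  have e0 k : (0 < e k <= l)%R.
    by rewrite divr_gt0//= ler_pdivrMr// ler_peMr ?(ltW l0)// ler1n.
  have /choice[A hA] : forall k, exists A : set (Rinfty R),
      [/\ measurable A, Pinf A <= (l^-1 * (2 * e k))%:E &
      forall w, ~ A w -> \forall n \near \oo,
      (`|n%:R^-1 * \sum_(i < n) g (w i) - mu| <= 3 * l)%R].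
    by move=> k; exact: average_near_mean.
  have mA k : measurable (A k) by have [] := hA k.
  exists (\bigcap_k A k); split.
  - by apply: bigcap_measurableType.
  - apply/eqP; rewrite -measure_le0; apply/lee_addgt0Pr => r r0.
    rewrite add0e.
    pose k := Num.trunc (2 / r).
    have kr : (2 / k.+1%:R <= r)%R.
      rewrite ler_pdivrMr// mulrC -ler_pdivrMr// ltW//.
      exact: truncnS_gt.
    apply: (@le_trans _ _ (Pinf (A k))).
      apply: le_measure; rewrite ?inE//; first exact: bigcap_measurableType.
      exact: bigcap_inf.
    have [_ + _] := hA k; move/le_trans; apply; rewrite lee_fin.
    by rewrite (_ : (_ * _)%R = (2 / k.+1%:R)%R)// /e; field;
      rewrite nat1r pnatr_eq0 (gt_eqF l0).
  - move=> w /= nw k _; apply: contrapT => Akw; apply: nw.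
    by have [_ _] := hA k; apply.
have : {ae Pinf, forall w : Rinfty R, forall k, \forall n \near \oo,
    (`|n%:R^-1 * \sum_(i < n) g (w i) - mu| <= 3 * k.+1%:R^-1)%R}.
  by apply: ae_foralln => k; apply: negl; rewrite invr_gt0.
apply: filterS => w hw; apply/cvgrPdist_le => e e0.
pose k := Num.trunc (3 / e).
have ke : (3 * k.+1%:R^-1 <= e)%R.
  by rewrite ler_pdivrMr// mulrC -ler_pdivrMr// ltW// truncnS_gt.
by apply: filterS (hw k) => n; rewrite distrC => /le_trans; apply.
Qed.
End strong_law.

(** * The strong law uniformly over a family approximated by a sequence *)

Section uniform_law.
Set Implicit Arguments.
Unset Strict Implicit.

(** Finiteness is assumed for the infimum of [b] only: the uniform bound then excludes -oo for that
    of [a], and a point of [T] excludes +oo. *)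
Lemma ereal_inf_dist (R : realType) (I : Type) (T : set I) (a b : I -> R)
    (e : R) : T !=set0 -> (forall t, T t -> (`|a t - b t| <= e)%R) ->
  ereal_inf [set (b t)%:E | t in T] \is a fin_num ->
  `|ereal_inf [set (a t)%:E | t in T] - ereal_inf [set (b t)%:E | t in T]|
    <= e%:E.
Proof.
move=> [t0 Tt0] ab bfin; set i := ereal_inf [set (a t)%:E | t in T].
set r := fine (ereal_inf [set (b t)%:E | t in T]).
have rE : ereal_inf [set (b t)%:E | t in T] = r%:E by rewrite fineK.
have ia t : T t -> i <= (a t)%:E.
  by move=> Tt; apply: ereal_inf_lbound; exists t.
have rb t : T t -> (r <= b t)%R.
  by move=> Tt; rewrite -lee_fin -rE; apply: ereal_inf_lbound; exists t.
have ri : (r - e)%:E <= i.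
  apply: le_ereal_inf_tmp => _ [t Tt <-]; rewrite lee_fin.
  by have := ab _ Tt; have := rb _ Tt; rewrite ler_norml => ? /andP[? ?]; lra.
have ir : i - e%:E <= r%:E.
  rewrite -rE; apply: le_ereal_inf_tmp => _ [t Tt <-].
  rewrite leeBlDr// (le_trans (ia _ Tt))// -EFinD lee_fin.
  by have := ab _ Tt; rewrite ler_norml => /andP[? ?]; lra.
rewrite rE; have := ia _ Tt0.
case: i ri ir {ia} => [i| |] //=; rewrite ?leNye_eq// !lee_fin => ri ir _.
by rewrite ler_norml; apply/andP; split; lra.
Qed.

Context (R : realType) (P : probability (measurableTypeR R) R).
Context (Pinf : probability (Rinfty R) R) (hP : is_infinite_power P Pinf).
Context (I : Type) (T : set I) (phi : I -> R -> R).
Context (int_phi : forall t, T t ->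
  P.-integrable [set: measurableTypeR R] (EFin \o phi t)).
Context (S : set (measurableTypeR R)) (mS : measurable S) (PS : P (~` S) = 0).
Context (G : R -> R).
Context (intG : P.-integrable [set: measurableTypeR R] (EFin \o G)).
Context (G0 : forall x, (0 <= G x)%R).
(** One sequence [c] serves all [e], which gives a countable infimum and hence measurability; for
    fixed [e] its first [K] terms suffice for all [t], which gives uniformity. *)
Context (c : nat -> I) (Tc : forall i, T (c i)).
Context (net : forall e : R, (0 < e)%R -> exists K, forall t, T t ->
  exists2 i, (i < K)%N &
    forall x, S x -> (`|phi t x - phi (c i) x| <= e * G x)%R).

Let theta := ereal_inf [set \int[P]_x (phi t x)%:E | t in T].
Context (theta_fin : theta \is a fin_num).

Let mean (h : R -> R) n (w : Rinfty R) : R :=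
  (n%:R^-1 * \sum_(k < n) h (w k))%R.
Let ex (h : R -> R) : R := fine (\int[P]_x (h x)%:E).

Let good := [set w : Rinfty R | forall k, S (w k)].

Let measurable_good : measurable good.
Proof.
rewrite (_ : good = \bigcap_k (@coordinate R k @^-1` S)).
  apply: bigcap_measurableType => k _; rewrite -[X in measurable X]setTI.
  exact: measurable_coord.
by apply/seteqP; split => w h k; [move=> _; exact: h|exact: (h k Logic.I)].
Qed.

Let ae_good : {ae Pinf, forall w : Rinfty R, good w}.
Proof.
apply: ae_foralln => k; exists (@coordinate R k @^-1` (~` S)); split => //.
  rewrite -[X in measurable X]setTI; apply: measurable_coord => //.
  exact: measurableC.
by rewrite -PS; apply: (coord_law hP); exact: measurableC.
Qed.

Let mean_dist t u e n w : good w -> (0 <= e)%R ->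
  (forall x, S x -> (`|phi t x - phi u x| <= e * G x)%R) ->
  (`|mean (phi t) n w - mean (phi u) n w| <= e * mean G n w)%R.
Proof.
move=> gw e0 tu; rewrite /mean -mulrBr -sumrB normrM ger0_norm ?invr_ge0//.
rewrite mulrCA ler_wpM2l ?invr_ge0// (le_trans (ler_norm_sum _ _ _))//.
by rewrite mulr_sumr; apply: ler_sum => k _; exact/tu/gw.
Qed.

(** The pointwise bound holds on [S] only, so the integrals are compared almost everywhere. *)
Let ex_dist t u e : T t -> T u -> (0 <= e)%R ->
  (forall x, S x -> (`|phi t x - phi u x| <= e * G x)%R) ->
  (`|ex (phi t) - ex (phi u)| <= e * ex G)%R.
Proof.
move=> Tt Tu e0 tu.
have fG : \int[P]_x (G x)%:E \is a fin_num by exact: integrable_fin_num.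
rewrite -lee_fin EFinM fineK// -abse_EFin EFinB !fineK; last 2 first.
- by apply: integrable_fin_num => //; exact: int_phi.
- by apply: integrable_fin_num => //; exact: int_phi.
have mt : measurable_fun [set: measurableTypeR R] (phi t).
  by apply/measurable_EFinP; exact: measurable_int (int_phi Tt).
have mu : measurable_fun [set: measurableTypeR R] (phi u).
  by apply/measurable_EFinP; exact: measurable_int (int_phi Tu).
have mG : measurable_fun [set: measurableTypeR R] G.
  by apply/measurable_EFinP; exact: measurable_int intG.
rewrite -integralB//; [|exact: int_phi|exact: int_phi].
rewrite (le_trans (le_abse_integral _ _ _))//.
  exact/measurable_EFinP/measurable_funB.
rewrite -ge0_integralZl//; last 2 first.
- exact/measurable_EFinP.
- by move=> x _; rewrite lee_fin.
apply: ae_ge0_le_integral => //.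
- apply: measurableT_comp => //; exact/measurable_EFinP/measurable_funB.
- by move=> x _; rewrite mule_ge0 ?lee_fin.
- by apply: measurable_funeM; exact/measurable_EFinP.
- exists (~` S); split => //; first exact: measurableC.
  by move=> x /= nh Sx; apply: nh => _; rewrite lee_fin tu.
Qed.

Let cinf n w := ereal_inf [set (mean (phi (c i)) n w)%:E | i in [set: nat]].

(** For a sample in [S], every mean is a limit of means along [c], so the larger family has no
    smaller infimum. *)
Let estimatorE n w : good w -> importance_estimator T phi n w = cinf n w.
Proof.
move=> gw; apply/eqP; rewrite eq_le; apply/andP; split.
  apply: ereal_inf_le_tmp => _ [i _ <-]; exists (c i) => //.
apply: le_ereal_inf_tmp => _ [t Tt <-]; apply/lee_addgt0Pr => e e0.
have mG0 : (0 <= mean G n w)%R by rewrite mulr_ge0 ?invr_ge0 ?sumr_ge0.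
(* The added 1 keeps the denominator positive when the mean of [G] is 0. *)
pose e' := (e / (mean G n w + 1))%R.
have e'0 : (0 < e')%R by rewrite divr_gt0// ltr_wpDl.
have [K /(_ _ Tt)[i _ ti]] := net e'0.
apply: (@le_trans _ _ (mean (phi (c i)) n w)%:E).
  by apply: ereal_inf_lbound; exists i.
rewrite -EFinD lee_fin -/(mean (phi t) n w).
have := mean_dist n gw (ltW e'0) ti.
have : (e' * mean G n w <= e)%R.
  rewrite /e' mulrAC ler_pdivrMr ?ltr_wpDl//; nra.
rewrite ler_norml => h1 /andP[h2 h3]; lra.
Qed.

(* The value +oo off the null set where the estimator may fail to be measurable
   keeps this above the estimator's error everywhere. *)
Let cover n w := if w \in good then `|cinf n w - theta| else +oo.

Let measurable_cover n : measurable_fun [set: Rinfty R] (cover n).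
Proof.
apply: measurable_fun_ifT => //.
- apply: (measurable_fun_bool true).
  rewrite (_ : _ @^-1` _ = good) ?setTI//.
  by apply/seteqP; split => w /=; [exact: set_mem|exact: mem_set].
- apply: measurableT_comp => //; apply: emeasurable_funB => //.
  rewrite (_ : cinf n = fun w => einfs (fun i => (mean (phi (c i)) n w)%:E) 0%N).
    apply: measurable_fun_einfs => i; apply/measurable_EFinP.
    apply: measurable_funM => //; apply: measurable_sum => k.
    have mc : measurable_fun [set: measurableTypeR R] (phi (c i)).
      by apply/measurable_EFinP; exact: measurable_int (int_phi (Tc i)).
    exact: (measurableT_comp mc (@measurable_coord R k)).
  by apply/funext => w; rewrite /einfs /cinf; congr ereal_inf;
    apply/seteqP; split => _ [i _ <-]; exists i.
Qed.

Theorem uniform_strong_law : strongly_consistent Pinf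
  (importance_estimator T phi) theta.
Proof.
exists cover; split.
  move=> n; split.
  - exact: measurable_cover.
  - move=> w; rewrite /cover; case: ifPn => [|_]; last by rewrite leey.
    by rewrite inE => gw; rewrite estimatorE.
  (* On [good] the cover equals the error itself, so any majorant is above it there. *)
  - move=> h mh hh; apply: filterS ae_good => w gw.
    by rewrite /cover mem_set// -estimatorE.
have slln_c : {ae Pinf, forall w : Rinfty R, forall i,
    mean (phi (c i)) n w @[n --> \oo] --> ex (phi (c i))}.
  apply: ae_foralln => i; apply: strong_law_of_large_numbers => //.
  exact: int_phi.
have slln_G : {ae Pinf, forall w : Rinfty R,
    mean G n w @[n --> \oo] --> ex G}.
  exact: strong_law_of_large_numbers.
apply: filterS3 ae_good slln_c slln_G => w gw wc wG.
have coverE n : cover n w = `|importance_estimator T phi n w - theta|.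
  by rewrite /cover mem_set// estimatorE.
have EG0 : (0 <= ex G)%R.
  by rewrite fine_ge0// integral_ge0// => x _; rewrite lee_fin.
have close (e : R) : (0 < e)%R -> \forall n \near \oo, cover n w <= e%:E.
  (* The budget: e' (ex G + 1) between sample means, e / 2 for the strong law at [c i], and e' (ex
     G) between expectations, in total [e]. *)
  move=> e0; pose e' := (e / 2 / (2 * ex G + 1))%R.
  have D0 : (0 < 2 * ex G + 1)%R by rewrite ltr_wpDl// mulr_ge0.
  have e'0 : (0 < e')%R by rewrite !divr_gt0.
  have e'E : (e' * (2 * ex G + 1) = e / 2)%R by rewrite /e' divfK ?gt_eqF.
  have [K hK] := net e'0.
  have ncG : \forall n \near \oo, (mean G n w <= ex G + 1)%R.
    have /cvgrPdist_le/(_ 1%R ltr01) := wG; apply: filterS => n.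
    by rewrite ler_norml => /andP[h1 h2]; lra.
  (* Finitely many indices, so one threshold for [n] serves them all. *)
  have ncc : \forall n \near \oo, forall i : 'I_K,
      (`|mean (phi (c i)) n w - ex (phi (c i))| <= e / 2)%R.
    apply: filter_forall => i.
    have e20 : (0 < e / 2)%R by rewrite divr_gt0.
    have /cvgrPdist_le/(_ _ e20) := wc i.
    by apply: filterS => n; rewrite distrC.
  apply: filterS2 ncG ncc => n hG hc; rewrite coverE /theta.
  have thetaE : [set \int[P]_x (phi t x)%:E | t in T] =
                [set (ex (phi t))%:E | t in T].
    apply: eq_imagel => t Tt; rewrite fineK// integrable_fin_num//.
    exact: int_phi.
  rewrite thetaE; apply: ereal_inf_dist.
  - by exists (c 0%N).
  - move=> t Tt; have [i iK ti] := hK t Tt.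
    have := mean_dist n gw (ltW e'0) ti.
    have := ex_dist Tt (Tc i) (ltW e'0) ti.
    have := hc (Ordinal iK); rewrite /= -/(mean (phi t) n w) !ler_norml.
    have : (e' * mean G n w <= e' * (ex G + 1))%R by rewrite ler_wpM2l// ltW.
    move=> h1 /andP[? ?] /andP[? ?] /andP[? ?]; apply/andP.
    have : (e' * (2 * ex G + 1) = e' * (ex G + 1) + e' * ex G)%R by ring.
    by rewrite e'E; split; lra.
  - by rewrite -thetaE.
have cover0 n : 0 <= cover n w by rewrite coverE.
(* Extended real convergence amounts to eventual finiteness, here from [close] at 1, and convergence
   of the real values. *)
apply/fine_cvgP; split.
  apply: filterS (close _ ltr01) => n h.
  by rewrite ge0_fin_numE// (le_lt_trans h)// ltry.
apply/cvgrPdist_le => e e0; apply: filterS (close _ e0) => n h.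
rewrite sub0r normrN ger0_norm ?fine_ge0//.
by rewrite -lee_fin fineK// ge0_fin_numE// (le_lt_trans h)// ltry.
Qed.

End uniform_law.

(** * Integration against a density *)

Section densities.
Set Implicit Arguments.
Unset Strict Implicit.
Context (R : realType).
Implicit Types (Q : probability (measurableTypeR R) R) (q u : R -> R).

(** [q] and the Radon-Nikodym derivative of [Q] have the same integral over every measurable set, so
    they agree almost everywhere, and the change of variables carries over to [q]. *)
Lemma ge0_integral_density Q q (u : R -> \bar R) : is_density Q q ->
    measurable_fun [set: measurableTypeR R] u -> (forall x, 0 <= u x) ->
  \int[Q]_x u x = \int[lebesgue_measure]_x (u x * (q x)%:E).
Proof.
move=> [mq q0 Qq] mu u0.
have Qleb : Q `<< @lebesgue_measure R.
  apply/null_content_dominatesP => A mA A0.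
  rewrite Qq// null_set_integral//; exact/measurable_EFinP/measurable_funTS.
pose h := Radon_Nikodym_SigmaFinite.f Q (@lebesgue_measure R).
have mh : measurable_fun [set: measurableTypeR R] h.
  exact: measurable_int (Radon_Nikodym_SigmaFinite.f_integrable Qleb).
rewrite -(Radon_Nikodym_SigmaFinite.change_of_variables Qleb)//.
apply: ge0_ae_eq_integral => //.
- exact: emeasurable_funM.
- by apply: emeasurable_funM => //; exact/measurable_EFinP.
- by move=> x _; rewrite mule_ge0// Radon_Nikodym_SigmaFinite.f_ge0.
- by move=> x _; rewrite mule_ge0// lee_fin.
- apply: ae_eqe_mul2l; apply: integral_ae_eq => //.
  + exact: Radon_Nikodym_SigmaFinite.f_integrable.
  + exact/measurable_EFinP.
  + move=> A _ mA; rewrite -Qq//; apply/esym.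
    exact: (Radon_Nikodym_SigmaFinite.f_integral Qleb).
Qed.

(** As densities are nonnegative, the pointwise identity passes to positive and negative parts,
    which are integrated separately. *)
Lemma integral_density_eq Q q Q' q' u u' : is_density Q q -> is_density Q' q' ->
    measurable_fun [set: measurableTypeR R] u ->
    measurable_fun [set: measurableTypeR R] u' ->
    (forall x, (u x * q x = u' x * q' x)%R) ->
  \int[Q]_x (u x)%:E = \int[Q']_x (u' x)%:E.
Proof.
move=> dQ dQ' /measurable_EFinP mu /measurable_EFinP mu' uq.
have [_ q0 _] := dQ; have [_ q'0 _] := dQ'.
rewrite integralE [RHS]integralE; congr (_ - _).
- rewrite (ge0_integral_density dQ) ?(ge0_integral_density dQ')//.
  + apply: eq_integral => x _; rewrite !funeposE -!EFin_max -!EFinM.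
    by rewrite !maxr_pMl// !mul0r uq.
  + exact: measurable_funepos.
  + exact: measurable_funepos.
- rewrite (ge0_integral_density dQ) ?(ge0_integral_density dQ')//.
  + apply: eq_integral => x _; rewrite !funenegE -!EFinN -!EFin_max -!EFinM.
    by rewrite !maxr_pMl// !mul0r !mulNr uq.
  + exact: measurable_funeneg.
  + exact: measurable_funeneg.
Qed.

Lemma measurable_supp q : measurable_fun [set: measurableTypeR R] q ->
  measurable (supp q : set (measurableTypeR R)).
Proof.
move=> mq; rewrite (_ : supp q = setT `&` q @^-1` `]0%R, +oo[%classic).
  exact: mq.
by rewrite setTI; apply/seteqP; split => x; rewrite /supp/= in_itv/= andbT.
Qed.

Lemma measure_setC_supp Q q : is_density Q q -> Q (~` supp q) = 0.
Proof.
move=> [mq q0 Qq]; rewrite Qq; last first.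
  by apply: measurableC; exact: measurable_supp.
rewrite (eq_integral (cst 0)) ?integral0// => x.
rewrite inE /supp /= => /negP; rewrite -leNgt => qx.
by congr EFin; apply/eqP; rewrite eq_le qx q0.
Qed.

End densities.

(** * Finite nets of a bounded set for an arbitrary norm *)

Section nets.
Set Implicit Arguments.
Unset Strict Implicit.
Context (R : realType) (m : nat) (N : 'rV[R]_m -> R) (hN : is_norm N).
Context (T : set 'rV[R]_m) (T0 : T !=set0) (Tb : bounded_set T).
Local Open Scope ring_scope.

(** Expansion in the canonical basis and the triangle inequality; [C] is the sum of the norms of the
    basis vectors. *)
Lemma norm_le_coordinates : exists2 C : R, 0 <= C &
  forall (v : 'rV[R]_m) (e : R), (forall i, `|v ord0 i| <= e) -> N v <= e * C.
Proof.
have [N0 _ NZ ND] := hN.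
exists (\sum_(i < m) N (delta_mx ord0 i)); first exact: sumr_ge0.
move=> v e ve; rewrite {1}[v]row_sum_delta mulr_sumr.
elim/big_ind2 : _ => [|x1 x2 y1 y2 h1 h2|i _].
- by have := NZ 0 0; rewrite scale0r normr0 mul0r => ->.
- by rewrite (le_trans (ND _ _))// lerD.
- by rewrite NZ ler_wpM2r.
Qed.

(** A cube around [T] is cut into cells of side [de], and one point of [T] is kept from each cell
    that meets [T]. *)
Lemma bounded_finite_net (e : R) : 0 < e -> exists s : seq 'rV[R]_m,
  (forall x, x \in s -> T x) /\
  forall t, T t -> exists2 x, x \in s & N (t - x) <= e.
Proof.
move=> e0; have [C C0 NC] := norm_le_coordinates.
have [t0 Tt0] := T0.
have [M0 [_ hM0]] := Tb.
pose M := M0 + 1.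
have TM t i : T t -> `|t ord0 i| <= M.
  move=> Tt; have := hM0 M; rewrite ltrDl ltr01 => /(_ isT t Tt) /=.
  by apply: le_trans; rewrite [leRHS]/Num.norm /= mx_normrE;
    apply/bigmax_geP; right;
    exists (ord0, i).
(* Points of one cell are within [de * C], hence [e], in the norm [N]; the added 1 covers [C] =
   0. *)
pose de := e / (C + 1).
have de0 : 0 < de by rewrite divr_gt0// ltr_wpDl.
pose J := Num.trunc ((M + M) / de).
(* Adding [M] makes coordinates nonnegative, so that [Num.trunc] is the floor; on [T], [cell_bounds]
   keeps [inord] from its default value. *)
pose cell (t : 'rV[R]_m) : {ffun 'I_m -> 'I_J.+1} :=
  [ffun i => inord (Num.trunc ((t ord0 i + M) / de))].
have cell_bounds t i : T t -> let a := (t ord0 i + M) / de in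
    0 <= a /\ (Num.trunc a < J.+1)%N.
  move=> /(TM _ i); rewrite ler_norml => /andP[tM Mt].
  have a0 : 0 <= (t ord0 i + M) / de by rewrite divr_ge0 ?(ltW de0)//; lra.
  split => //; rewrite ltnS; apply: le_truncn.
  by rewrite ler_pM2r ?invr_gt0// lerD2r.
have same s t : T s -> T t -> cell s = cell t -> N (s - t) <= e.
  move=> Ts Tt st; apply: (@le_trans _ _ (de * C)).
    apply: NC => i; rewrite !mxE.
    have [a0 aJ] := cell_bounds s i Ts; have [b0 bJ] := cell_bounds t i Tt.
    have /(congr1 val) := congr1 (fun h : {ffun 'I_m -> 'I_J.+1} => h i) st.
    rewrite !ffunE /= !inordK// => abE.
    have /andP[a1 a2] := truncn_itv a0; have /andP[b1 b2] := truncn_itv b0.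
    move: a2 b1 b2; rewrite -abE -natr1 => a2 b1 b2.
    have -> : s ord0 i - t ord0 i =
        ((s ord0 i + M) / de - (t ord0 i + M) / de) * de by field; lra.
    rewrite normrM (gtr0_norm de0) ler_piMl ?(ltW de0)// ler_norml.
    by move: a1 a2 b1 b2; move: (_ / de) (_ / de) => A B *; lra.
  by rewrite /de mulrAC ler_pdivrMr ?ltr_wpDl// ler_wpM2l ?(ltW e0)// lerDl.
(* The default [t0] for cells that miss [T] keeps all values in [T]. *)
pose rep a : 'rV[R]_m := if pselect (exists2 t, T t & cell t = a) is left h
  then projT1 (cid2 h) else t0.
exists [seq rep a | a : {ffun 'I_m -> 'I_J.+1}]; split.
  move=> x /mapP[a _ ->]; rewrite /rep; case: pselect => // h.
  by case: cid2.
move=> t Tt; exists (rep (cell t)); first by apply: map_f; rewrite mem_enum.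
rewrite /rep; case: pselect => [h|]; last by case; exists t.
by case: cid2 => s Ts st /=; exact: same.
Qed.

(** The nets of radius 1 / (k + 1) are merged into one sequence through the codes of pairs (k, i);
    codes without a net point give [t0]. *)
Lemma bounded_dense_sequence : exists c : nat -> 'rV[R]_m,
  (forall i, T (c i)) /\
  forall e : R, 0 < e -> exists K, forall t, T t ->
    exists2 i, (i < K)%N & N (t - c i) <= e.
Proof.
have [t0 Tt0] := T0.
have /choice[s hs] : forall k : nat, exists s : seq 'rV[R]_m,
    (forall x, x \in s -> T x) /\
    forall t, T t -> exists2 x, x \in s & N (t - x) <= k.+1%:R^-1.
  by move=> k; apply: bounded_finite_net; rewrite invr_gt0.
exists (fun n => if unpickle n is Some (k, i) then nth t0 (s k) i else t0).
split.
  move=> n; case: unpickle => [[k i]|//].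
  have [ik|ik] := ltnP i (size (s k)); last by rewrite nth_default.
  by have [+ _] := hs k; apply; exact: mem_nth.
move=> e e0; pose k := Num.trunc e^-1.
have ke : k.+1%:R^-1 <= e.
  by rewrite invf_ple ?posrE// ltW// truncnS_gt.
(* A number above the codes of all points of the [k]-th net. *)
exists (\max_(i < size (s k)) pickle (k, val i)).+1 => t Tt.
have [_ /(_ t Tt)[x xs tx]] := hs k.
have ix : (index x (s k) < size (s k))%N by rewrite index_mem.
exists (pickle (k, index x (s k))).
  by rewrite ltnS (leq_bigmax (Ordinal ix)).
by rewrite pickleK nth_index// (le_trans tx).
Qed.

End nets.

(** * Reduction to a nonnegative Lipschitz factor *)

Section envelope.
Set Implicit Arguments.
Unset Strict Implicit.

(* F can take negative values only if T is a singleton, where F = 0 will do. *)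
Lemma nonneg_Lipschitz_envelope (R : realType) (m : nat) (T : set 'rV[R]_m)
  (nrm : 'rV[R]_m -> R) (hnrm : is_norm nrm) (pt : 'rV[R]_m -> R -> R)
  (f : R -> R) :
  (exists F : R -> R,
     [/\ measurable_fun [set: measurableTypeR R] F,
         \int[lebesgue_measure]_x (`|f x| * F x)%R%:E < +oo &
         forall s t, T s -> T t -> forall x,
           (`|pt s x - pt t x| <= nrm (s - t) * F x)%R]) ->
  exists F : R -> R,
     [/\ measurable_fun [set: measurableTypeR R] F, forall x, (0 <= F x)%R,
         \int[lebesgue_measure]_x (`|f x| * F x)%R%:E < +oo &
         forall s t, T s -> T t -> forall x,
           (`|pt s x - pt t x| <= nrm (s - t) * F x)%R].
Proof.
move=> [F [mF intF FL]]; have [N0 Neq0 _ _] := hnrm.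
have [[s [t [Ts Tt st]]]|hT] :=
    pselect (exists s t, [/\ T s, T t & s <> t]).
  exists F; split => // x.
  have st0 : (0 < nrm (s - t))%R.
    rewrite lt_def N0 andbT; apply/eqP => /Neq0/eqP.
    by rewrite subr_eq0 => /eqP.
  by rewrite -(pmulr_rge0 _ st0) (le_trans _ (FL s t Ts Tt x)).
exists (cst 0%R); split => //.
  by under eq_integral do rewrite mulr0; rewrite integral0.
move=> s t Ts Tt x; have -> : s = t.
  by apply: contrapT => st; apply: hT; exists s, t.
by rewrite subrr normr0 mulr0.
Qed.

End envelope.

(** * Lipschitz densities fulfil the conditions of the uniform strong law *)

Theorem theorem15 (R : realType) (m : nat) (hm : (0 < m)%N)
  (T : set 'rV[R]_m) (hT0 : T !=set0) (hTb : bounded_set T)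
  (nrm : 'rV[R]_m -> R) (hnrm : is_norm nrm)
  (Pt : 'rV[R]_m -> probability (measurableTypeR R) R)
  (pt : 'rV[R]_m -> R -> R)
  (hpt : forall t, T t -> is_density (Pt t) (pt t))
  (P : probability (measurableTypeR R) R) (p : R -> R)
  (hp : is_density P p)
  (hsupp : forall t, T t -> supp (pt t) `<=` supp p)
  (f : R -> R) (hf : measurable_fun [set: measurableTypeR R] f)
  (hfint : ereal_sup [set 'E_(Pt t)[fun x => `|f x|%R] | t in T] < +oo)
  (ft : 'rV[R]_m -> R -> R)
  (hftm : forall t, T t -> measurable_fun [set: measurableTypeR R] (ft t))
  (hft : forall t, T t ->
     forall x, supp p x -> ft t x = (f x * pt t x / p x)%R)
  (Pinf : probability (Rinfty R) R) (hPinf : is_infinite_power P Pinf)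
  (hF : exists F : R -> R,
     [/\ measurable_fun [set: measurableTypeR R] F,
         \int[lebesgue_measure]_x (`|f x| * F x)%R%:E < +oo &
         forall s t, T s -> T t -> forall x,
           (`|pt s x - pt t x| <= nrm (s - t) * F x)%R]) :
  strongly_consistent Pinf (importance_estimator T ft)
    (lower_expectation T Pt f).
Proof.
have [F [mF F0 intF FL]] := nonneg_Lipschitz_envelope hnrm hF.
have [mp p0 _] := hp.
have [c [Tc netc]] := bounded_dense_sequence hnrm hT0 hTb.
(* After multiplication by [p] the identity holds on the whole line: off [supp p] both densities
   vanish, by [hsupp]. *)
have ft_density t : T t -> forall x, (ft t x * p x = f x * pt t x)%R.
  move=> Tt x; have [px|px] := pselect (supp p x).
    by rewrite hft// divfK// gt_eqF.
  have [_ pt0 _] := hpt _ Tt.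
  have -> : p x = 0%R.
    by apply/eqP; rewrite eq_le p0 leNgt andbT; exact/negP.
  have -> : pt t x = 0%R.
    apply/eqP; rewrite eq_le pt0 leNgt andbT; apply/negP => ptx.
    exact/px/(hsupp _ Tt).
  by rewrite !mulr0.
have ftE t : T t -> \int[P]_x (ft t x)%:E = \int[Pt t]_x (f x)%:E.
  move=> Tt; apply: (integral_density_eq hp (hpt _ Tt)) => //.
    exact: hftm.
  exact: ft_density.
have ft_absE t : T t -> \int[P]_x `|ft t x|%:E = \int[Pt t]_x `|f x|%:E.
  move=> Tt; apply: (integral_density_eq hp (hpt _ Tt)).
  - by apply: measurableT_comp => //; exact: hftm.
  - exact: measurableT_comp.
  - move=> x; have [_ pt0 _] := hpt _ Tt.
    rewrite -[X in (_ * X)%R]ger0_norm// -normrM ft_density// normrM.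
    by rewrite [X in (_ * X)%R]ger0_norm.
pose M := ereal_sup [set 'E_(Pt t)[fun x => `|f x|%R] | t in T].
have abs_le t : T t -> \int[Pt t]_x `|f x|%:E <= M.
  by move=> Tt; apply: ereal_sup_ubound; exists t => //; rewrite unlock.
have int_ft t : T t -> P.-integrable [set: measurableTypeR R] (EFin \o ft t).
  move=> Tt; apply/integrableP; split.
    by apply/measurable_EFinP; exact: hftm.
  have := ft_absE _ Tt; rewrite /= => ->.
  exact: le_lt_trans (abs_le _ Tt) hfint.
(* G vanishes off supp p because x / 0 = 0. *)
pose G x := (`|f x| * F x / p x)%R.
have mG : measurable_fun [set: measurableTypeR R] G.
  (* The inverse becomes a real power, whose measurability is known; both agree since [p] is
     nonnegative. *)
  rewrite (_ : G = fun x => `|f x| * F x * (p x `^ (-1)))%R; last first.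
    by apply/funext => x; rewrite powR_inv1.
  apply: measurable_funM.
    by apply: measurable_funM => //; exact: measurableT_comp.
  exact: (measurableT_comp (measurable_powR (-1)%R) mp).
have G0 x : (0 <= G x)%R by rewrite divr_ge0 ?mulr_ge0.
have intG : P.-integrable [set: measurableTypeR R] (EFin \o G).
  apply/integrableP; split; first exact/measurable_EFinP.
  under eq_integral do rewrite /= ger0_norm//.
  rewrite (ge0_integral_density hp)//; last exact/measurable_EFinP.
  apply: le_lt_trans intF; apply: ge0_le_integral => //.
  - by move=> x _; rewrite mule_ge0 ?lee_fin.
  - by apply: emeasurable_funM; exact/measurable_EFinP.
  - apply/measurable_EFinP; apply: measurable_funM => //.
    exact: measurableT_comp.
  (* [G x * p x] equals |f| F where [p] is nonzero and is 0 elsewhere. *)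
  - move=> x _; rewrite -EFinM lee_fin /G.
    have [->|px] := eqVneq (p x) 0%R; first by rewrite mulr0 mulr_ge0.
    by rewrite divfK.
have net e : (0 < e)%R -> exists K, forall t, T t -> exists2 i, (i < K)%N &
    forall x, supp p x -> (`|ft t x - ft (c i) x| <= e * G x)%R.
  move=> e0; have [K hK] := netc _ e0; exists K => t Tt.
  have [i iK ti] := hK _ Tt; exists i => // x px.
  (* On [supp p] the difference is |f| / p times a difference of densities, to which the Lipschitz
     bound applies. *)
  rewrite !hft// -mulrBl -mulrBr !normrM.
  rewrite (ger0_norm (x := (p x)^-1)) ?invr_ge0//.
  rewrite /G mulrA ler_wpM2r ?invr_ge0// mulrCA ler_wpM2l//.
  by rewrite (le_trans (FL _ _ Tt (Tc i) x))// ler_wpM2r.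
have lowerE : lower_expectation T Pt f =
    ereal_inf [set \int[P]_x (ft t x)%:E | t in T].
  congr ereal_inf; apply: eq_imagel => t Tt.
  by rewrite ftE// unlock.
rewrite lowerE; apply: (uniform_strong_law hPinf int_ft
  (measurable_supp mp) (measure_setC_supp hp) intG G0 Tc net).
(* It remains to see that the lower expectation is finite: all expectations lie between [- M] and
   [M], and [T] is nonempty. *)
rewrite -lowerE; have [t0 Tt0] := hT0.
have M0 : 0 <= M by apply: le_trans (abs_le _ Tt0); exact: integral_ge0.
have Mfin : M \is a fin_num by rewrite ge0_fin_numE.
have Et t : T t -> `|'E_(Pt t)[f]| <= M.
  move=> Tt; rewrite unlock; apply: le_trans (abs_le _ Tt).
  by apply: le_abse_integral => //; exact/measurable_EFinP.
rewrite fin_numElt; apply/andP; split.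
  apply: (@lt_le_trans _ _ (- M)); first by rewrite -(fineK Mfin) -EFinN ltNyr.
  apply: le_ereal_inf_tmp => _ [t Tt <-].
  by rewrite leeNl (le_trans _ (Et _ Tt))// -abseN lee_abs.
apply: (@le_lt_trans _ _ M) => //.
apply: (@le_trans _ _ 'E_(Pt t0)[f]).
  by apply: ereal_inf_lbound; exists t0.
exact: le_trans (lee_abs _) (Et _ Tt0).
Qed.
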